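(* Let $L$ be a non-metabelian graded Lie algebra of maximal class (infinite-dimensional) over a field of characteristic $p$ (a priori, $p$ is a prime or zero). Then $p>0$, and the first constituent of $L$ has length $2q$ for some power $q$ of $p$. Furthermore, if $p$ is odd then the second constituent of $L$ has length $q$.
   Context: All Lie algebras are infinite-dimensional. A graded Lie algebra of maximal class is a graded Lie algebra $L=\bigoplus_{i=1}^{\infty}L_i$ over a field $F$ with $\dim L_1=2$, $\dim L_i=1$ for $i>1$, and $[L_i,L_1]=L_{i+1}$ for all $i\ge 1$. Lie products are left-normed: $[abc]=[[ab]c]$, and $[ab^i]=[ab\cdots b]$ with $b$ occurring $i$ times (so $[ab^0]=a$); an expression such as $[vyx^iy]$ is read in the same left-normed way. Constituent lengths. Suppose $L$ is non-metabelian (that is, $[L^2,L^2]\ne 0$ where $L^2=[L,L]$). The centralizer $C_{L_1}(L_2)$ is one-dimensional; write $C_{L_1}(L_2)=Fy$. Since $L$ is not metabelian, some $L_i$ with $i\ge 2$ is not centralized by $y$. Let $\ell=\ell_1$ be the least integer $i\ge 2$ such that $[L_i,y]\neq 0$; $\ell_1$ is the length of the first constituent. Let $x\in L_1$ be a nonzero element with $C_{L_1}(L_\ell)=Fx$. Set $v_1=[yx^{\ell-1}]\in L_\ell$. Recursively for $r>1$, let $\ell_r$ (the length of the $r$-th constituent) be the smallest positive integer such that $[v_{r-1}yx^{\ell_r-1}y]\neq 0$ (such an integer always exists), and set $v_r=[v_{r-1}yx^{\ell_r-1}]$. *)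

(* Defs.v *)
From HB Require Import structures.
From mathcomp Require Import all_boot all_order all_algebra.
From mathcomp Require Import boolp classical_sets.

Set Implicit Arguments.
Unset Strict Implicit.
Unset Printing Implicit Defensive.

Import GRing.Theory.
Local Open Scope classical_set_scope.
Local Open Scope ring_scope.

HB.mixin Record Lmodule_isLieAlgebra (F : fieldType) L of GRing.Lmodule F L := {
  lie : L -> L -> L;
  lie_linear_l : forall v, linear (lie ^~ v);
  lie_linear_r : forall u, linear (lie u);
  lie_alternating : forall u, lie u u = 0;
  lie_jacobi : forall u v w,
    lie (lie u v) w + lie (lie v w) u + lie (lie w u) v = 0 }.

#[short(type="lieAlgType")]
HB.structure Definition LieAlgebra (F : fieldType) :=
  {L of Lmodule_isLieAlgebra F L & GRing.Lmodule F L}.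

Definition has_char (F : fieldType) (p : nat) : Prop :=
  p \in [pchar F] \/ (p = 0%N /\ [pchar F] =i pred0).

Section Subspaces.
Variables (F : fieldType) (L : lmodType F).

Definition subspace (V : set L) : Prop :=
  V 0 /\ forall (c : F) (u v : L), V u -> V v -> V (c *: u + v).

Definition lin_span (A : set L) : set L :=
  [set u | exists n (c : 'I_n -> F) (a : 'I_n -> L),
     (forall i, A (a i)) /\ u = \sum_(i < n) c i *: a i].

Definition lin_free n (b : 'I_n -> L) : Prop :=
  forall c : 'I_n -> F, \sum_(i < n) c i *: b i = 0 -> forall i, c i = 0.

Definition has_dim (V : set L) (n : nat) : Prop :=
  exists b : 'I_n -> L, lin_free b /\ V = lin_span (range b).

Definition line (u : L) : set L := [set v | exists c : F, v = c *: u].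

End Subspaces.

Section LieAlgebras.
Variables (F : fieldType) (L : lieAlgType F).

(* The product [A, B] of two sets is the subspace spanned by the products of
   their elements, not just the set of these products. *)
Definition lie_set (A B : set L) : set L :=
  lin_span [set w | exists u v, [/\ A u, B v & w = lie u v]].

Definition derived : set L := lie_set setT setT.

Definition metabelian : Prop := lie_set derived derived = [set 0].

(* The left-normed product [a b^i]. *)
Definition lie_iter (a b : L) (i : nat) : L := iter i (lie^~ b) a.

Definition centralizer (A B : set L) : set L :=
  [set u | A u /\ forall v, B v -> lie v u = 0].

(* L is the internal direct sum of the L_ i for i >= 1; the value of L_ at 0
   is never used. *)
Record graded_lie (L_ : nat -> set L) : Prop := GradedLie {
  graded_subspace : forall i, (0 < i)%N -> subspace (L_ i);
  graded_sum : forall u : L, exists n (f : nat -> L),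
    (forall i, (0 < i)%N -> L_ i (f i)) /\ u = \sum_(1 <= i < n) f i;
  graded_direct : forall n (f : nat -> L),
    (forall i, (0 < i)%N -> L_ i (f i)) -> \sum_(1 <= i < n) f i = 0 ->
    forall i, (0 < i < n)%N -> f i = 0;
  graded_lieM : forall i j, (0 < i)%N -> (0 < j)%N ->
    lie_set (L_ i) (L_ j) `<=` L_ (i + j)%N }.

Record graded_maximal_class (L_ : nat -> set L) : Prop := GradedMaximalClass {
  maxclass_graded : graded_lie L_;
  maxclass_dim1 : has_dim (L_ 1%N) 2;
  maxclass_dim : forall i, (1 < i)%N -> has_dim (L_ i) 1;
  maxclass_gen : forall i, (0 < i)%N -> lie_set (L_ i) (L_ 1%N) = L_ i.+1 }.

Definition is_least (P : nat -> Prop) (n : nat) : Prop :=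
  P n /\ forall m, P m -> (n <= m)%N.

Variable L_ : nat -> set L.

Definition first_length (y : L) : nat -> Prop :=
  is_least (fun i => (1 < i)%N /\ lie_set (L_ i) [set y] <> [set 0]).

(* constituent y x r l v: the r-th constituent, r >= 1, computed with y and x,
   has length l = l_r, and v = v_r. *)
Inductive constituent (y x : L) : nat -> nat -> L -> Prop :=
| first_constituent l :
    first_length y l -> constituent y x 1 l (lie_iter y x l.-1)
| next_constituent r k v l :
    constituent y x r k v ->
    is_least (fun i =>
      (0 < i)%N /\ lie (lie_iter (lie v y) x i.-1) y <> 0) l ->
    constituent y x r.+1 l (lie_iter (lie v y) x l.-1).

Definition adapted (y x : L) : Prop :=
  [/\ y <> 0, centralizer (L_ 1%N) (L_ 2%N) = line y, x <> 0 &
      exists2 l, first_length y l & centralizer (L_ 1%N) (L_ l) = line x].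

(* y and x are determined only up to nonzero scalars: the length does not
   depend on their choice. *)
Definition constituent_length (r l : nat) : Prop :=
  (exists y x, adapted y x) /\
  forall y x, adapted y x -> exists v, constituent y x r l v.

End LieAlgebras.

(* Main.v *)
(* Put m = l_1 - 1, v = [y x^m] and w_s = [v y x^s]. Since [y x^i y] = 0 for
   i < m and [y x^(m+1)] = 0, expanding a product of two elements [y x^i]
   leaves a single term:
     [[y x^(m-d)], [y x^j]] = (-1)^d C(j, d) w_(j-d).
   As [u, u] = 0, this forces m to be odd. Taking j = m + 1 gives
   C(l_1, s) w_s = 0, and bracketing with y, when [y x^j] and [y x^(m-d)] both
   commute with y, gives C(j, s) [w_s y] = 0 for s < j < m. Let t be minimal
   with [w_(t-1) y] <> 0.
   - If t > l_1 / 2, then w_s <> 0 for s <= l_1 / 2, so the characteristic p is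
     positive and divides C(l_1, s) for 0 < s < l_1; hence l_1 is a power of p,
     and as it is even, p = 2.
   - If t <= l_1 / 2, then p divides C(j, t - 1) for t <= j <= l_1 - 2, so the
     exact power of p dividing t is at least l_1 - t >= t; hence t is a power of
     p and l_1 = 2t. Here t is the length of the second constituent. *)
Require Import Defs.
From mathcomp Require Import all_boot all_order all_algebra.
From mathcomp Require Import boolp classical_sets.
From mathcomp Require Import zify ring.

Set Implicit Arguments.
Unset Strict Implicit.
Unset Printing Implicit Defensive.

Import GRing.Theory.
Local Open Scope classical_set_scope.
Local Open Scope ring_scope.

(** * Binomial coefficients modulo a prime *)

Lemma dvdn_bin_pexp p b i :
  prime p -> (0 < i < p ^ b)%N -> (p %| 'C(p ^ b, i))%N.
Proof.
move=> pp /andP[i0 ib]; apply/contraT => npC.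
have : (p ^ b %| i * 'C(p ^ b, i))%N.
  by case: i i0 ib {npC} => // i _ _; rewrite -mul_bin_diag dvdn_mulr.
rewrite Gauss_dvdl ?coprimeXl ?prime_coprime //.
by move=> /(dvdn_leq i0); rewrite leqNgt ib.
Qed.

(** A case of Lucas' congruence, by induction on [n] in steps of [p ^ b]: in the Vandermonde
    expansion for [n = p ^ b + (n - p ^ b)] only the two extreme terms survive modulo [p]. *)
Lemma bin_pexp p b n : prime p -> 'C(n, p ^ b) = n %/ p ^ b %[mod p].
Proof.
move=> pp; have pb0 : (0 < p ^ b)%N by rewrite expn_gt0 prime_gt0.
have := @dvdn_bin_pexp p b ^~ pp; case: (p ^ b)%N pb0 => // m _ dvdC.
have [k] := ubnP n; elim: k n => // k IH n /ltnSE nk.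
have [nm|mn] := ltnP n m.+1; first by rewrite bin_small // divn_small.
rewrite -{1 2}(subnKC mn) divnDl // divnn /= -binomial.Vandermonde.
rewrite big_ord_recr big_ord_recl /= bin0 mul1n subn0 subnn bin0 binn muln1.
rewrite [in LHS]addnAC -modnDm (eqP (dvdn_sum _ _)) ?addn0 => [|i _].
  by rewrite addnC modn_mod; apply/eqP; rewrite eqn_modDl; apply/eqP/IH; lia.
by rewrite dvdn_mulr // dvdC //= /bump; have := ltn_ord i; lia.
Qed.

(** Write [l = r * p ^ e] with [r] prime to [p]. If [r >= 2], then [s = p ^ e] is allowed, but 'C(l,
    p ^ e) is congruent to [r]. *)
Lemma pexp_of_dvdn_bin p l :
    prime p -> (0 < l)%N ->
    (forall s, (0 < s <= l./2)%N -> (p %| 'C(l, s))%N) ->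
  exists e, l = (p ^ e)%N.
Proof.
move=> pp l0 dvdC; have [r pr lE] := pfactor_coprime pp l0.
set e := logn p l in lE; exists e.
have pe0 : (0 < p ^ e)%N by rewrite expn_gt0 prime_gt0.
have [r2|] := leqP 2 r; last by case: r lE {pr} => [|[|]] //; lia.
have /dvdC : (0 < p ^ e <= l./2)%N by nia.
rewrite /dvdn bin_pexp // lE mulnK //.
by move: pr; rewrite prime_coprime // /dvdn => /negPf ->.
Qed.

(** Write [t = r * p ^ e] with [r] prime to [p]. For [j = t.-1 + p ^ e] the binomial is 'C(j, p ^
    e), congruent to [r], so this [j] exceeds [M]. Then [t <= M.+2 - t <= p ^ e <= t], and equality
    holds throughout. *)
Lemma pexp_of_dvdn_bin_col p t M :
    prime p -> (0 < t)%N -> (2 * t <= M.+2)%N ->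
    (forall j, (t <= j <= M)%N -> (p %| 'C(j, t.-1))%N) ->
  (exists e, t = (p ^ e)%N) /\ (2 * t)%N = M.+2.
Proof.
move=> pp t0 tM dvdC; have [r pr tE] := pfactor_coprime pp t0.
set e := logn p t in tE.
have pe0 : (0 < p ^ e)%N by rewrite expn_gt0 prime_gt0.
have r0 : (0 < r)%N by lia.
suff Mt : (M < t.-1 + p ^ e)%N.
  have r1 : r = 1%N by nia.
  by split; [exists e; rewrite tE r1 mul1n | nia].
rewrite ltnNge; apply/negP => leM.
have /dvdC : (t <= t.-1 + p ^ e <= M)%N by lia.
rewrite -bin_sub ?leq_addr // addKn /dvdn bin_pexp //.
have -> : (t.-1 + p ^ e = r * p ^ e + (p ^ e).-1)%N by lia.
rewrite divnMDl // (@divn_small (p ^ e).-1) ?prednK // addn0.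
by move: pr; rewrite prime_coprime // /dvdn => /negPf ->.
Qed.

Lemma has_char_natf0 (F : fieldType) p n :
  has_char F p -> (0 < n)%N -> n%:R = 0 :> F -> p \in [pchar F].
Proof.
case=> // -[_ F0] n0 /eqP nF0.
by have [p' pF] := natf0_pchar n0 nF0; have := F0 p'; rewrite pF.
Qed.

(** * Lie identities and the arithmetic of the constituent lengths *)

Section LieIdentities.
Variables (F : fieldType) (L : lieAlgType F).
Implicit Types (a : F) (u v w x y : L).

Lemma lieDl u v w : lie (u + v) w = lie u w + lie v w.
Proof. by have := lie_linear_l w 1 u v; rewrite !scale1r. Qed.

Lemma lieDr u v w : lie u (v + w) = lie u v + lie u w.
Proof. by have := lie_linear_r u 1 v w; rewrite !scale1r. Qed.

Lemma lie0l v : lie 0 v = 0.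
Proof. by apply: (addrI (lie 0 v)); rewrite -lieDl !addr0. Qed.

Lemma lie0r u : lie u 0 = 0.
Proof. by apply: (addrI (lie u 0)); rewrite -lieDr !addr0. Qed.

Lemma lieZl a u v : lie (a *: u) v = a *: lie u v.
Proof. by have := lie_linear_l v a u 0; rewrite !addr0 lie0l addr0. Qed.

Lemma lieZr a u v : lie u (a *: v) = a *: lie u v.
Proof. by have := lie_linear_r u a v 0; rewrite !addr0 lie0r addr0. Qed.

Lemma lie_suml I (r : seq I) (P : pred I) (f : I -> L) v :
  lie (\sum_(i <- r | P i) f i) v = \sum_(i <- r | P i) lie (f i) v.
Proof. by apply: (big_morph (lie^~ v)) => [u w|]; rewrite ?lieDl ?lie0l. Qed.

Lemma lie_sumr I (r : seq I) (P : pred I) (f : I -> L) u :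
  lie u (\sum_(i <- r | P i) f i) = \sum_(i <- r | P i) lie u (f i).
Proof. by apply: (big_morph (lie u)) => [v w|]; rewrite ?lieDr ?lie0r. Qed.

Lemma lieN u v : lie u v = - lie v u.
Proof.
apply/eqP; rewrite -addr_eq0; apply/eqP.
have := lie_alternating (u + v).
by rewrite lieDl !lieDr !lie_alternating add0r addr0.
Qed.

Lemma lieNl u v : lie (- u) v = - lie u v.
Proof. by rewrite -scaleN1r lieZl scaleN1r. Qed.

Lemma lie_lier u v w : lie u (lie v w) = lie (lie u v) w - lie (lie u w) v.
Proof.
rewrite (lieN u (lie v w)); have := lie_jacobi u v w.
by rewrite (lieN w u) lieNl addrAC => /eqP; rewrite addr_eq0 => /eqP ->.
Qed.

Lemma lie_iterS u v i : lie_iter u v i.+1 = lie (lie_iter u v i) v.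
Proof. by []. Qed.

(* For j < d the subtraction truncates, but then the binomial vanishes. *)
Lemma lie_lie_iter x y m j d :
    (forall i, (i < m)%N -> lie (lie_iter y x i) y = 0) ->
    lie_iter y x m.+1 = 0 -> (d <= m)%N ->
  lie (lie_iter y x (m - d)) (lie_iter y x j) =
  ((-1) ^+ d * 'C(j, d)%:R) *: lie_iter (lie (lie_iter y x m) y) x (j - d).
Proof.
move=> yxy0 yx0; elim: j d => [|j IH] [|d] dm.
- by rewrite subn0 bin0 mul1r scale1r.
- by rewrite bin0n mulr0 scale0r yxy0 //; lia.
- rewrite lie_iterS lie_lier IH // !subn0 -[lie _ x in X in _ - X]lie_iterS.
  by rewrite yx0 lie0l subr0 !bin0 !mul1r !scale1r.
(* Bracketing the first factor with [x] turns [d.+1] into [d], so the two induction hypotheses add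
   up by Pascal's rule. *)
rewrite lie_iterS lie_lier -[lie _ x in X in _ - X]lie_iterS.
rewrite (_ : (m - d.+1).+1 = m - d)%N; last by lia.
rewrite !IH ?(ltnW dm) // lieZl subSS binS natrD.
have [jd|dj] := leqP j d.
  rewrite (@bin_small j d.+1) // mulr0 scale0r add0r add0r -scaleNr.
  by rewrite exprS mulN1r mulNr.
by rewrite -lie_iterS subnSK // -scalerBl; congr (_ *: _); rewrite exprS; ring.
Qed.


(** The arithmetic core, free of the grading, with [m.+1] in the role of l_1. Maximal class enters
    through the last hypothesis: [x] and [y] never both kill a nonzero [w s]. *)
Lemma constituent_arith (p m : nat) x y
    (w := lie_iter (lie (lie_iter y x m) y) x) :
    has_char F p -> (1 < m)%N ->
    (forall i, (i < m)%N -> lie (lie_iter y x i) y = 0) ->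
    lie_iter y x m.+1 = 0 -> w 0%N <> 0 ->
    (forall s, w s <> 0 -> lie (w s) y = 0 -> w s.+1 <> 0) ->
  (0 < p)%N /\ exists h : nat, m.+1 = (2 * p ^ h)%N /\
    (odd p -> is_least (fun i => (0 < i)%N /\ lie (w i.-1) y <> 0) (p ^ h)%N).
Proof.
move=> hp m1 yxy0 yx0 w0 wS.
have adE := lie_lie_iter _ yxy0 yx0; rewrite -/w in adE.
have sgn_bin0 d n (u : L) :
    ((-1) ^+ d * n%:R) *: u = 0 -> u <> 0 -> n%:R = 0 :> F.
  move=> /eqP; rewrite scaler_eq0 mulf_eq0 signr_eq0 /= => /orP[/eqP//|/eqP u0].
  by move=> /(_ u0).
(* For even [m], taking [d = j = m./2] gives [u, u] on the left and [w 0] up to sign on the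
   right. *)
have [k mE] : exists k, m = k.*2.+1.
  exists m./2; rewrite -[LHS]odd_double_half; case: (boolP (odd m)) => // mev.
  have := adE m./2 m./2 ltac:(lia).
  rewrite (_ : m - m./2 = m./2)%N; last by lia.
  rewrite lie_alternating subnn binn => /esym/sgn_bin0/(_ w0)/eqP.
  by rewrite oner_eq0.
have bin_l s : (0 < s <= m.+1)%N -> w s <> 0 -> 'C(m.+1, s)%:R = 0 :> F.
  move=> s0m ws; have := adE m.+1 (m.+1 - s)%N ltac:(lia).
  rewrite yx0 lie0r subKn; last by lia.
  by rewrite bin_sub ?[(s <= _)%N]andbT; [move/esym/sgn_bin0; apply | lia].
(* Both factors on the left have exponent below [m], as [s < j < m]; they commute with [y], and so
   does their product. *)
have bin_col s j : lie (w s) y <> 0 -> (s < j < m)%N -> 'C(j, s)%:R = 0 :> F.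
  move=> wsy sj; have := adE j (j - s)%N ltac:(lia).
  move/(congr1 (lie^~ y)); rewrite /= lieZl subKn; last by lia.
  have -> : lie (lie (lie_iter y x (m - (j - s))) (lie_iter y x j)) y = 0.
    have := lie_lier (lie_iter y x (m - (j - s))) (lie_iter y x j) y.
    rewrite !yxy0; [|lia|lia].
    by rewrite lie0l lie0r subr0.
  by rewrite bin_sub; [move/esym/sgn_bin0; apply | lia].
(* As [m = 2k + 1], the bound [k.+1] is l_1 / 2. The case treated first is the one where [w 0], ...,
   [w k] all commute with [y], so that [wS] carries nonvanishing up to [w k.+1]. *)
case: (pselect (exists i, (i < k.+1)%N && (lie (w i) y != 0))); last first.
  move=> wy0.
  have wn0 s : (s <= k.+1)%N -> w s <> 0.
    elim: s => // s IH sk; apply: wS; first by apply: IH; lia.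
    by apply: contrapT => /eqP wsy; apply: wy0; exists s; rewrite sk.
  have pF : p \in [pchar F].
    apply: (has_char_natf0 hp (ltn0Sn m)).
    by rewrite -(bin1 m.+1); apply: bin_l => //; apply: wn0.
  have pp := pcharf_prime pF.
  have [||e lE] := @pexp_of_dvdn_bin p m.+1 pp.
  - by [].
  - move=> s s_le; rewrite (dvdn_pcharf pF); apply/eqP/bin_l; first by lia.
    by apply: wn0; lia.
  split; first exact: prime_gt0.
  case: e lE => [|e] lE; first by lia.
  (* The power [m.+1] of [p] is even; the claim for odd [p] is thus vacuous in this case. *)
  have p2 : p = 2%N.
    apply/eqP; have [] := even_prime pp => [->//|po].
    by move: (oddX p e.+1); rewrite -lE po orbT mE /= odd_double.
  by exists e; rewrite {2}p2; split => //; rewrite lE expnS p2.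
(* For the least such [s], the second constituent has length [t = s.+1]. *)
move=> /ex_minnP[s /andP[sk /eqP wsy] s_min].
have ws0 i : (i < s)%N -> lie (w i) y = 0.
  move=> si; apply: contrapT => /eqP wiy.
  by have := s_min i; rewrite wiy (ltn_trans si sk) => /(_ isT); lia.
have pF : p \in [pchar F].
  (* The entry [j = s.+1] of the column is [s.+1] itself; it is below [m] because [m] is odd and at
     least 3. *)
  apply: (has_char_natf0 hp (ltn0Sn s)).
  by rewrite -[in LHS](binSn s); apply: bin_col => //; lia.
have pp := pcharf_prime pF.
(* Here [M = m.-1], so that [M.+2] is l_1. *)
have [|||[e sE] lE] := @pexp_of_dvdn_bin_col p s.+1 m.-1 pp => //.
- by lia.
- by move=> j sj; rewrite (dvdn_pcharf pF); apply/eqP/bin_col => //=; lia.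
split; first exact: prime_gt0.
exists e; rewrite -sE; split; first by lia.
move=> _; split=> // i [i0 wiy].
by rewrite leqNgt; apply/negP => si; apply: wiy; apply: ws0; lia.
Qed.

End LieIdentities.

(** * Subspaces, lines and planes *)

Section LinearAlgebra.
Variables (F : fieldType) (L : lmodType F).
Implicit Types (A V : set L) (u v a b : L).

Lemma subspaceZ V c u : subspace V -> V u -> V (c *: u).
Proof. by move=> [V0 VD] Vu; rewrite -[_ *: _]addr0; apply: VD. Qed.

Lemma subspaceD V u v : subspace V -> V u -> V v -> V (u + v).
Proof. by move=> [_ VD] Vu Vv; rewrite -[u]scale1r; apply: VD. Qed.

Lemma subspace_sum V I (r : seq I) (P : pred I) (f : I -> L) :
  subspace V -> (forall i, P i -> V (f i)) -> V (\sum_(i <- r | P i) f i).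
Proof.
move=> Vs Vf; apply: big_ind => //; first by case: Vs.
by move=> u v; apply: subspaceD.
Qed.

Lemma lin_span_min A V : subspace V -> A `<=` V -> lin_span A `<=` V.
Proof.
move=> Vs AV u [n [c [a [Aa ->]]]]; apply: subspace_sum => // i _.
by apply: subspaceZ => //; apply: AV (Aa i).
Qed.

Lemma mem_lin_span A u : A u -> lin_span A u.
Proof.
move=> Au; exists 1%N, (fun=> 1), (fun=> u); split=> //.
by rewrite big_ord1 scale1r.
Qed.

Lemma lin_span_neq0 A : lin_span A <> [set 0] <-> exists2 u, A u & u <> 0.
Proof.
split=> [A0|[u Au u0] AE]; last first.
  by apply: u0; have := mem_lin_span Au; rewrite AE.
apply: contrapT => Anz; apply: A0; apply/seteqP; split=> [|_ ->]; last first.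
  exists 0%N, (fun=> 0), (fun=> 0); split; first by case.
  by rewrite big_ord0.
apply: lin_span_min => [|u Au].
  by split=> // c u v /= -> ->; rewrite scaler0 addr0.
by apply: contrapT => u0; apply: Anz; exists u.
Qed.

Lemma has_dim1_line V : has_dim V 1 -> exists2 a, a <> 0 & V = line a.
Proof.
move=> [b [bfree ->]]; exists (b ord0) => [b0|].
  have := bfree (fun=> 1); rewrite big_ord1 b0 scaler0 => /(_ erefl ord0)/eqP.
  by rewrite oner_eq0.
apply/seteqP; split=> [|_ [c ->]]; last first.
  exists 1%N, (fun=> c), (fun=> b ord0); split; first by move=> _; exists ord0.
  by rewrite big_ord1.
apply: lin_span_min => [|_ [i _ <-]]; last first.
  by exists 1; rewrite scale1r (ord1 i).
split=> [|c _ _ [d ->] [e ->]]; first by exists 0; rewrite scale0r.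
by exists (c * d + e); rewrite scalerDl scalerA.
Qed.

Lemma line_neq0E a u : line a u -> u <> 0 -> line a = line u.
Proof.
move=> [c ->] ca0; have c0 : c != 0.
  by apply/eqP => c0; apply: ca0; rewrite c0 scale0r.
apply/seteqP; split=> _ [d ->].
  by exists (d / c); rewrite scalerA divfK.
by exists (d * c); rewrite scalerA.
Qed.

Lemma has_dim1E V u : has_dim V 1 -> V u -> u <> 0 -> V = line u.
Proof. by move=> /has_dim1_line[a _ ->]; apply: line_neq0E. Qed.

Lemma has_dim2_basis V : has_dim V 2 -> exists a b,
  (forall c d, c *: a + d *: b = 0 -> c = 0 /\ d = 0) /\
  (forall v, V v <-> exists c d, v = c *: a + d *: b).
Proof.
move=> [b [bfree ->]]; exists (b ord0), (b ord_max); split=> [c d cd0|v].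
  have sum0 : \sum_(i < 2) (if i == ord0 then c else d) *: b i = 0.
    rewrite big_ord_recl big_ord1 /= -cd0; congr (_ *: _ + _ *: b _).
    exact: val_inj.
  by have bE := bfree _ sum0; split; [apply: (bE ord0) | apply: (bE ord_max)].
split=> [|[c [d ->]]]; last first.
  exists 2%N, (fun i => if i == ord0 then c else d), b.
  split=> [i|]; first by exists i.
  rewrite big_ord_recl big_ord1 /=; congr (_ *: _ + _ *: b _).
  exact: val_inj.
have bspan : subspace
    [set v | exists c d : F, v = c *: b ord0 + d *: b ord_max].
  split=> [|k _ _ [c [d ->]] [c' [d' ->]]].
    by exists 0, 0; rewrite !scale0r addr0.
  exists (k * c + c'), (k * d + d').
  by rewrite scalerDr !scalerDl !scalerA addrACA.
move: v; apply: (lin_span_min bspan) => _ [i _ <-].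
case: (unliftP ord0 i) => [j ->|->].
  exists 0, 1; rewrite scale0r scale1r add0r; congr (b _).
  by apply: val_inj; rewrite /= ord1.
by exists 1, 0; rewrite scale0r scale1r addr0.
Qed.

(** Cramer's rule in a basis [e], [f]; a vanishing determinant would put [b] on the line of [a]. *)
Lemma has_dim2_span V a b : has_dim V 2 -> V a -> V b -> a <> 0 -> ~ line a b ->
  forall v, V v -> exists c d, v = c *: a + d *: b.
Proof.
move=> /has_dim2_basis[e [f [_ VE]]] /VE[a1 [a2 aE]] /VE[b1 [b2 bE]] a0 abn.
move=> v /VE[v1 [v2 vE]].
have comb c d : c *: a + d *: b =
    (c * a1 + d * b1) *: e + (c * a2 + d * b2) *: f.
  by rewrite aE bE !scalerDr !scalerA !scalerDl addrACA.
have scl c : c *: a = (c * a1) *: e + (c * a2) *: f.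
  by have := comb c 0; rewrite scale0r !mul0r !addr0.
have [D0|D0] := eqVneq (a1 * b2 - a2 * b1) 0.
  move/eqP: D0; rewrite subr_eq0 => /eqP D0; case: abn.
  have [a10|a10] := eqVneq a1 0; last first.
    exists (b1 / a1); rewrite scl bE divfK //; congr (_ + _ *: f).
    by apply: (mulfI a10); rewrite D0; field.
  have [a20|a20] := eqVneq a2 0.
    by case: a0; rewrite aE a10 a20 !scale0r addr0.
  exists (b2 / a2); rewrite scl bE divfK //; congr (_ *: e + _).
  by apply: (mulfI a20); rewrite -D0; field.
exists ((v1 * b2 - v2 * b1) / (a1 * b2 - a2 * b1)).
exists ((v2 * a1 - v1 * a2) / (a1 * b2 - a2 * b1)).
by rewrite comb vE; congr (_ *: e + _ *: f); field.
Qed.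

End LinearAlgebra.

(** * Structure of graded Lie algebras of maximal class *)

Section MaximalClass.
Variables (F : fieldType) (L : lieAlgType F) (L_ : nat -> set L).
Hypothesis hL : graded_maximal_class L_.

Let gL : graded_lie L_ := maxclass_graded hL.
Let subL i : (0 < i)%N -> subspace (L_ i) := @graded_subspace _ _ _ gL i.

Lemma lie_set_neq0 (A B : set L) :
  lie_set A B <> [set 0] <-> exists u v, [/\ A u, B v & lie u v <> 0].
Proof.
rewrite lin_span_neq0; split=> [[_ [u [v [Au Bv ->]]] uv0]|[u [v [Au Bv uv0]]]].
  by exists u, v.
by exists (lie u v) => //; exists u, v.
Qed.

Lemma lie_homog i j u v :
  (0 < i)%N -> (0 < j)%N -> L_ i u -> L_ j v -> L_ (i + j)%N (lie u v).
Proof.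
move=> i0 j0 Lu Lv; apply: (graded_lieM gL i0 j0).
by apply: mem_lin_span; exists u, v.
Qed.

Lemma lie_homog1 i u v : (0 < i)%N -> L_ i u -> L_ 1%N v -> L_ i.+1 (lie u v).
Proof. by move=> i0 Lu Lv; rewrite -addn1; apply: lie_homog. Qed.

Lemma lie_iter_homog i k u v :
  (0 < i)%N -> L_ i u -> L_ 1%N v -> L_ (i + k)%N (lie_iter u v k).
Proof.
move=> i0 Lu Lv; elim: k => [|k IH]; first by rewrite addn0.
by rewrite addnS lie_iterS; apply: lie_homog1 => //; rewrite addn_gt0 i0.
Qed.

Lemma lie_L1_neq0 i : (0 < i)%N ->
  exists u a, [/\ L_ i u, L_ 1%N a & lie u a <> 0].
Proof.
move=> i0; apply/lie_set_neq0; rewrite (maxclass_gen hL i0).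
have [e e0 ->] := has_dim1_line (maxclass_dim hL (i0 : (1 < i.+1)%N)).
by move=> E; apply: e0; have : line e e; [exists 1; rewrite scale1r | rewrite E].
Qed.

(** Bracketing with a generator [z] of L_i maps the plane L_1 onto the line L_(i+1), so its kernel
    is a line. If [z] sends [e] to [s *: g] and [f] to [t *: g], the kernel is spanned by
    [t *: e - s *: f]. *)
Lemma centralizer_line i : (1 < i)%N ->
  exists2 y, y <> 0 & centralizer (L_ 1%N) (L_ i) = line y.
Proof.
move=> i1; have i0 : (0 < i)%N by lia.
have [z z0 LiE] := has_dim1_line (maxclass_dim hL i1).
have [g g0 LSE] := has_dim1_line (maxclass_dim hL (ltnW i1 : (1 < i.+1)%N)).
have [e [f [ef0 L1E]]] := has_dim2_basis (maxclass_dim1 hL).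
have Lz : L_ i z by rewrite LiE; exists 1; rewrite scale1r.
have zL1 u : L_ 1%N u -> line g (lie z u).
  by move=> Lu; rewrite -LSE; apply: lie_homog1.
have [|s zeE] := zL1 e.
  by apply/L1E; exists 1, 0; rewrite scale1r scale0r addr0.
have [|t zfE] := zL1 f.
  by apply/L1E; exists 0, 1; rewrite scale1r scale0r add0r.
have zE c d : lie z (c *: e + d *: f) = (c * s + d * t) *: g.
  by rewrite lieDr !lieZr zeE zfE !scalerA scalerDl.
have st0 : ~ (s = 0 /\ t = 0).
  move=> [s0 t0]; have [u [a [Lu /L1E[c [d ->]]]]] := lie_L1_neq0 i0.
  move: Lu; rewrite LiE => -[k ->]; apply.
  by rewrite lieZl zE s0 t0 !mulr0 addr0 scale0r scaler0.
have zyE c d : c * s + d * t = 0 ->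
    exists k, c *: e + d *: f = k *: (t *: e - s *: f).
  move=> /eqP; rewrite addr_eq0 => /eqP cd.
  have [t0|t0] := eqVneq t 0.
    have s0 : s != 0 by apply/eqP => s0; apply: st0.
    exists (- (d / s)); rewrite t0 scale0r add0r.
    move: cd; rewrite t0 mulr0 oppr0 => /eqP; rewrite mulf_eq0 (negPf s0) orbF.
    move=> /eqP->; rewrite scale0r add0r scalerN scaleNr opprK scalerA.
    by rewrite divfK.
  exists (c / t); rewrite scalerBr !scalerA divfK // -scaleNr.
  congr (_ + _ *: f); apply: (mulIf t0).
  by rewrite -[d * t]opprK -cd; field.
exists (t *: e - s *: f).
  by rewrite -scaleNr => /ef0[t0 /eqP]; rewrite oppr_eq0 => /eqP s0; apply: st0.
apply/seteqP; split=> [u [/L1E[c [d ->]] /(_ z Lz)]|_ [k ->]].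
  rewrite zE => /eqP; rewrite scaler_eq0 => /orP[/eqP/zyE //|/eqP g0'].
  by case: g0.
split=> [|v].
  by apply: subspaceZ; [apply: subL | apply/L1E; exists t, (- s); rewrite scaleNr].
rewrite LiE => -[k' ->]; rewrite lieZl lieZr -scaleNr zE.
by rewrite mulNr (mulrC s) subrr scale0r !scaler0.
Qed.

Section Generators.
Variables x y : L.
Hypotheses (Lx : L_ 1%N x) (Ly : L_ 1%N y) (y0 : y <> 0) (yxn : ~ line y x).

Let spanL1 := has_dim2_span (maxclass_dim1 hL) Ly Lx y0 yxn.

Lemma lie_gens_neq0 : lie y x <> 0.
Proof.
move=> yx0; have [u [a [/spanL1[c [d ->]] /spanL1[c' [d' ->]]]]] :=
  lie_L1_neq0 (ltn0Sn 0); apply.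
rewrite !(lieDl, lieDr) !(lieZl, lieZr) !lie_alternating (lieN x y) yx0 oppr0.
by rewrite !scaler0 !addr0.
Qed.

(** Since [u] spans L_i and [x], [y] span L_1, the vanishing of both products would give [L_i, L_1]
    = 0. *)
Lemma lie_x_neq0 i u :
  (1 < i)%N -> L_ i u -> u <> 0 -> lie u y = 0 -> lie u x <> 0.
Proof.
move=> i1 Lu u0 uy0 ux0; have [|w [a [Lw]]] := @lie_L1_neq0 i; first by lia.
move=> /spanL1[c [d ->]]; apply; move: Lw.
rewrite (has_dim1E (maxclass_dim hL i1) Lu u0) => -[k ->].
by rewrite lieZl lieDr !lieZr uy0 ux0 !scaler0 addr0 scaler0.
Qed.

Lemma lie_iter_yx_neq0 m :
    (forall i, (0 < i < m)%N -> lie (lie_iter y x i) y = 0) ->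
  forall i, (i <= m)%N -> lie_iter y x i <> 0.
Proof.
move=> yxy0; elim=> [//|[|i] IH] im; first exact: lie_gens_neq0.
apply: (@lie_x_neq0 i.+2 (lie_iter y x i.+1)) => //; first exact: (@lie_iter_homog 1 i.+1).
  by apply: IH; lia.
by apply: yxy0; lia.
Qed.

End Generators.

(** A product of homogeneous components has degree at least 2. This reduces linear conditions on L^2
    to homogeneous elements. *)
Lemma derived_min (V : set L) :
  subspace V -> (forall i, (1 < i)%N -> L_ i `<=` V) -> @derived F L `<=` V.
Proof.
move=> Vs LV; apply: lin_span_min => // _ [u [v [_ _ ->]]].
have [n [f [Lf ->]]] := graded_sum gL u.
have [k [g [Lg ->]]] := graded_sum gL v.
rewrite lie_suml big_nat_cond; apply: subspace_sum => // i; rewrite andbT => ni.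
rewrite lie_sumr big_nat_cond; apply: subspace_sum => // j; rewrite andbT => kj.
by apply: (LV (i + j)%N); [lia|apply: lie_homog; [lia|lia|apply: Lf|apply: Lg]; lia].
Qed.

(** By Jacobi and induction on [k], every [y x^k] centralizes all L_i with [i > 1]; for [k > 0]
    these elements span the L_j with [j > 1]. *)
Lemma metabelian_of_centralizing y : y <> 0 -> L_ 1%N y ->
  (forall i u, (1 < i)%N -> L_ i u -> lie u y = 0) -> metabelian L.
Proof.
move=> y0 Ly yc.
(* This [x] does not centralize L_2 while [y] does, so together they span L_1. *)
have [u [x [Lu Lx ux0]]] := lie_L1_neq0 (ltn0Sn 1).
have yxn : ~ line y x.
  by move=> [c xE]; apply: ux0; rewrite xE lieZr (yc 2) // scaler0.
have Lyx i : L_ i.+1 (lie_iter y x i) by apply: (@lie_iter_homog 1).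
have yxc k i w : (1 < i)%N -> L_ i w -> lie w (lie_iter y x k) = 0.
  elim: k i w => [|k IH] i w i1 Lw; first exact: (yc i).
  rewrite lie_iterS lie_lier (IH i) // lie0l (IH i.+1) ?subr0 //; first by lia.
  by apply: lie_homog1 => //; lia.
have LL0 i j w v : (1 < i)%N -> (1 < j)%N -> L_ i w -> L_ j v -> lie w v = 0.
  move=> i1; case: j => // -[//|j] j1 Lw.
  rewrite (has_dim1E (maxclass_dim hL j1) (Lyx j.+1)).
    by move=> [c ->]; rewrite lieZr (yxc _ i) // scaler0.
  apply: (lie_iter_yx_neq0 Lx Ly y0 yxn) (leqnn _) => k kj.
  by apply: (yc k.+1) => //; lia.
apply: contrapT => /lie_set_neq0[a [b [Da Db]]]; apply.
(* One factor at a time: the elements annihilating L^2 form a subspace, and so do those annihilated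
   by a fixed [w]. *)
move: a Da b Db; apply: derived_min.
  split=> [b _|c a a' aD aD' b Db]; first exact: lie0l.
  by rewrite lieDl lieZl aD // aD' // scaler0 addr0.
move=> i i1 w Lw; apply: derived_min.
  split=> [|c b b' wb wb']; first exact: lie0r.
  by rewrite /= lieDr lieZr wb wb' scaler0 addr0.
by move=> j j1 v; apply: (LL0 i j).
Qed.

Lemma adapted_exists : ~ metabelian L -> exists y x, adapted L_ y x.
Proof.
move=> nmet; have [y y0 yE] := @centralizer_line 2 isT.
have [Ly _] : centralizer (L_ 1%N) (L_ 2) y.
  by rewrite yE; exists 1; rewrite scale1r.
have : exists i, `[< (1 < i)%N /\ lie_set (L_ i) [set y] <> [set 0] >].
  apply: contrapT => nex; apply/nmet/(metabelian_of_centralizing y0 Ly).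
  move=> i u i1 Lu; apply: contrapT => uy0; apply: nex; exists i.
  by apply/asboolP; split=> //; apply/lie_set_neq0; exists u, y.
move=> /ex_minnP[l /asboolP lP lmin].
have [x x0 xE] := @centralizer_line l lP.1.
exists y, x; split=> //; exists l => //; split=> // i iP.
by apply: lmin; apply/asboolP.
Qed.

Lemma first_length_line y y' l l' : line y = line y' ->
  first_length L_ y l -> first_length L_ y' l' -> (l' <= l)%N.
Proof.
move=> yy' [[l1 /lie_set_neq0[u [_ [Lu -> uy0]]]] _] [_]; apply; split=> //.
apply/lie_set_neq0; exists u, y'; split=> // uy'0; apply: uy0.
have [c ->] : line y' y by rewrite -yy'; exists 1; rewrite scale1r.
by rewrite lieZr uy'0 scaler0.
Qed.

(** Both [y] and [y'] span the centralizer of L_2 in L_1, so they are proportional. *)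
Lemma adapted_first_length y x y' x' l l' : adapted L_ y x -> adapted L_ y' x' ->
  first_length L_ y l -> first_length L_ y' l' -> l = l'.
Proof.
move=> [_ yE _ _] [_ y'E _ _] ly ly'; rewrite yE in y'E.
by apply/eqP; rewrite eqn_leq (first_length_line y'E ly ly')
  (first_length_line (esym y'E) ly' ly).
Qed.

Lemma adapted_lengths p y x :
    has_char F p -> adapted L_ y x ->
  (0 < p)%N /\ exists h : nat, first_length L_ y (2 * p ^ h)%N /\
    (odd p -> exists v, constituent L_ y x 2 (p ^ h)%N v).
Proof.
move=> hp [y0 yE x0 [l ly xE]].
have [Ly yc] : centralizer (L_ 1%N) (L_ 2) y.
  by rewrite yE; exists 1; rewrite scale1r.
have [Lx xc] : centralizer (L_ 1%N) (L_ l) x.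
  by rewrite xE; exists 1; rewrite scale1r.
have [[l1 /lie_set_neq0[u [_ [Lu -> uy0]]]] lmin] := ly.
(* Since [y] centralizes L_2, the first length is not 2; this gives [1 < m] for the arithmetic
   core. *)
have l2 : (2 < l)%N.
  rewrite ltn_neqAle l1 andbT; apply/eqP => l2; apply: uy0; apply: yc.
  by rewrite l2.
case: l l1 l2 Lu lmin ly xc {xE} => // m l1 l2 Lu lmin ly xc.
(* On L_l, [x] acts as zero but [y] does not. *)
have yxn : ~ line y x.
  move=> [c xE]; have := xc u Lu; rewrite xE lieZr => /eqP.
  by rewrite scaler_eq0 => /orP[/eqP c0|/eqP//]; apply: x0; rewrite xE c0 scale0r.
have Lyx i : L_ i.+1 (lie_iter y x i) by apply: (@lie_iter_homog 1).
have yxy0 i : (i < m)%N -> lie (lie_iter y x i) y = 0.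
  case: i => [_|i im]; first exact: lie_alternating.
  apply: contrapT => yxy; suff : (m.+1 <= i.+2)%N by lia.
  by apply: lmin; split=> //; apply/lie_set_neq0; exists (lie_iter y x i.+1), y.
have v0 : lie_iter y x m <> 0.
  apply: (lie_iter_yx_neq0 Lx Ly y0 yxn) (leqnn m) => i im.
  by apply: yxy0; lia.
have [|||||p0 [h [mE odd_h]]] := @constituent_arith _ _ p m x y hp.
- by [].
- exact: yxy0.
- exact: xc.
(* L_l is spanned by [y x^m], so [w 0 = 0] would make [y] centralize L_l. *)
- move=> w0; apply: uy0; move: Lu.
  by rewrite (has_dim1E (maxclass_dim hL l1) (Lyx m) v0) => -[c ->];
    rewrite lieZl [lie _ y]w0 scaler0.
- move=> s ws0 wsy; apply: (@lie_x_neq0 x y Lx Ly y0 yxn (m.+2 + s)%N) => //.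
  by apply: lie_iter_homog => //; apply: lie_homog1.
split=> //; exists h; rewrite -mE; split=> // /odd_h lE.
exists (lie_iter (lie (lie_iter y x m) y) x (p ^ h)%N.-1).
by apply: next_constituent lE; apply: first_constituent ly.
Qed.

End MaximalClass.

Theorem theorem4 (F : fieldType) (p : nat) (hp : has_char F p)
    (L : lieAlgType F) (L_ : nat -> set L)
    (hL : graded_maximal_class L_) (hnm : ~ metabelian L) :
  (0 < p)%N /\
  exists q : nat,
    [/\ exists h : nat, q = (p ^ h)%N,
        constituent_length L_ 1 (2 * q)%N &
        odd p -> constituent_length L_ 2 q].
Proof.
have [y [x yx]] := adapted_exists hL hnm.
have [p0 [h [ly _]]] := adapted_lengths hL hp yx.
split=> //; exists (p ^ h)%N; split; first by exists h.
  split=> [|y' x' yx']; first by exists y, x.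
  have [_ [h' [ly' _]]] := adapted_lengths hL hp yx'.
  rewrite (adapted_first_length yx yx' ly ly').
  by eexists; apply: first_constituent.
move=> podd; split=> [|y' x' yx']; first by exists y, x.
(* The new pair brings its own exponent [h']; equality of the first lengths gives
   [p ^ h = p ^ h']. *)
have [_ [h' [ly' /(_ podd)]]] := adapted_lengths hL hp yx'.
by have /eqP := adapted_first_length yx yx' ly ly'; rewrite eqn_pmul2l // => /eqP ->.
Qed.
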